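(* Let $(M,\varphi,\xi,\eta,g)$ be a $(2n+1)$-dimensional almost contact manifold with Norden metric which belongs to the class $\mathcal{F}_{11}$. Then $$\tau+\tau^{\ast\ast}=2\,\mathrm{div}(\varphi\Omega)=2\rho(\xi,\xi),$$ where $\tau^{\ast\ast}=g^{is}g^{jk}R(e_i,e_j,\varphi e_k,\varphi e_s)$.
   Context: Let $M$ be a smooth manifold of dimension $2n+1$. An almost contact structure $(\varphi,\xi,\eta)$ on $M$ consists of an endomorphism $\varphi$ of the tangent bundle, a vector field $\xi$ and a 1-form $\eta$ with $\varphi^2=-\mathrm{Id}+\eta\otimes\xi$ and $\eta(\xi)=1$. A pseudo-Riemannian metric $g$ on $M$ is a Norden metric ($B$-metric) if $g(\varphi x,\varphi y)=-g(x,y)+\eta(x)\eta(y)$ for all vector fields $x,y$; then $(M,\varphi,\xi,\eta,g)$ is called an almost contact manifold with Norden metric. (It follows that $\varphi\xi=0$, $\eta\circ\varphi=0$, $\eta(x)=g(x,\xi)$, $g(\varphi x,y)=g(x,\varphi y)$, and $g$ has signature $(n+1,n)$.) Let $\nabla$ be the Levi-Civita connection of $g$ and put $F(x,y,z)=g((\nabla_x\varphi)y,z)$. Define the 1-form $\omega(x)=F(\xi,\xi,x)$ and let $\Omega$ be the vector field with $\omega(x)=g(x,\Omega)$. The manifold belongs to the class $\mathcal{F}_{11}$ (is an $\mathcal{F}_{11}$-manifold) if $F(x,y,z)=\eta(x)\{\eta(y)\omega(z)+\eta(z)\omega(y)\}$ for all vector fields $x,y,z$. Curvature conventions: $R(x,y)z=\nabla_x\nabla_yz-\nabla_y\nabla_xz-\nabla_{[x,y]}z$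 and $R(x,y,z,u)=g(R(x,y)z,u)$. With $\{e_i\}$ any basis of the whole tangent space $T_pM$ (all $2n+1$ basis vectors, including the $\xi$-direction), $(g^{ij})$ the inverse of the matrix $(g(e_i,e_j))$, and summation over repeated indices, the Ricci tensor is $\rho(y,z)=g^{ij}R(e_i,y,z,e_j)$ and the scalar curvature is $\tau=g^{ij}\rho(e_i,e_j)$. The divergence of a vector field $X$ is $\mathrm{div}X=\mathrm{tr}(x\mapsto\nabla_xX)$. *)

(* Defs.v *)
From HB Require Import structures.
From mathcomp Require Import all_boot all_order all_algebra.
From mathcomp Require Import all_classical all_reals all_analysis.
Export numFieldNormedType.Exports.

Set Implicit Arguments.
Unset Strict Implicit.
Unset Printing Implicit Defensive.

Import Order.TTheory GRing.Theory Num.Theory.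
Local Open Scope classical_set_scope.
Local Open Scope ring_scope.

(* [U] is meant to be open, so that the derivatives at points of [U] only
   depend on the values of [f] on [U]. *)
Fixpoint Ck_on (R : realType) (V W : normedModType R) (U : set V) (k : nat)
    (f : V -> W) : Prop :=
  match k with
  | 0 => forall a, U a -> {for a, continuous f}
  | k'.+1 => (forall a, U a -> differentiable f a) /\
             (forall v, Ck_on U k' ('D_v f))
  end.

Definition smooth_on (R : realType) (V W : normedModType R) (U : set V)
    (f : V -> W) : Prop := forall k, Ck_on U k f.

(* The smooth structure is given by an atlas indexed by the points, [chart p]
   being a chart around [p]; every atlas contains such a family (choose a chart
   around each point), and that family determines the same smooth structure.
   Outside of [chart_dom p] (resp. of its image) the values of [chart p]
   (resp. [chart_inv p]) are irrelevant. *)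
Record smooth_manifold (R : realType) (m : nat) := SmoothManifold {
  mspace :> topologicalType;
  mspace_hausdorff : hausdorff_space mspace;
  mspace_second_countable : @second_countable mspace;
  chart_dom : mspace -> set mspace;
  chart : mspace -> mspace -> 'rV[R]_m;
  chart_inv : mspace -> 'rV[R]_m -> mspace;
  chart_dom_nbhs : forall p, open_nbhs p (chart_dom p);
  chart_open : forall p, open (chart p @` chart_dom p);
  chartK : forall p q, chart_dom p q -> chart_inv p (chart p q) = q;
  chart_continuous : forall p q, chart_dom p q -> {for q, continuous (chart p)};
  chart_inv_continuous : forall p a, (chart p @` chart_dom p) a ->
    {for a, continuous (chart_inv p)};
  chart_smooth : forall p q,
    smooth_on (chart p @` (chart_dom p `&` chart_dom q))
              (chart q \o chart_inv p)
}.

Section VectorFields.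
Variables (R : realType) (m : nat) (M : smooth_manifold R m).

Definition smooth_at (W : normedModType R) (p : M) (f : M -> W) : Prop :=
  exists2 U : set 'rV[R]_m,
    open_nbhs (chart p p) U & smooth_on U (f \o chart_inv p).

(* The tangent space T_pM is 'rV[R]_m, a tangent vector at p being given by its
   components in the coordinate basis of [chart p]. Since this chart varies
   with p, the smoothness of a vector field is not that of the underlying
   function M -> 'rV[R]_m. *)
Definition vfield := M -> 'rV[R]_m.

(* v(f), for v in T_pM *)
Definition tderive (W : normedModType R) (p : M) (v : 'rV[R]_m) (f : M -> W)
  : W := 'D_v (f \o chart_inv p) (chart p p).

(* The k-th component of [fun q => tderive q (X q) (chart p)] is X(x^k), x^k
   being the k-th coordinate of [chart p]: this is the expression of X in that
   chart. *)
Definition smooth_vf_at (p : M) (X : vfield) : Prop :=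
  smooth_at p (fun q => tderive q (X q) (chart p)).

Definition smooth_vf (X : vfield) : Prop := forall p, smooth_vf_at p X.

(* The k-th component is X(Y(x^k)) - Y(X(x^k)), x^k as above. *)
Definition bracket (X Y : vfield) : vfield := fun p =>
  tderive p (X p) (fun q => tderive q (Y q) (chart p))
  - tderive p (Y p) (fun q => tderive q (X q) (chart p)).

End VectorFields.

Section Tensors.
Variables (R : realType) (m : nat) (M : smooth_manifold R m).
Variables (phi : M -> {linear 'rV[R]_m -> 'rV[R]_m}) (xi : vfield M).
Variables (eta : M -> {scalar 'rV[R]_m}) (g : M -> {biscalar 'rV[R]_m}).

Definition smooth_endo : Prop := forall p (X : vfield M),
  smooth_vf_at p X -> smooth_vf_at p (fun q => phi q (X q)).

Definition smooth_form : Prop := forall p (X : vfield M),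
  smooth_vf_at p X -> smooth_at p (fun q => eta q (X q) : R).

Record pseudo_riemannian : Prop := {
  metric_smooth : forall p (X Y : vfield M),
    smooth_vf_at p X -> smooth_vf_at p Y ->
    smooth_at p (fun q => g q (X q) (Y q) : R);
  metric_sym : forall p x y, g p x y = g p y x;
  metric_nondegenerate : forall p x, (forall y, g p x y = 0) -> x = 0
}.

Record almost_contact : Prop := {
  almost_contact_phi : smooth_endo;
  almost_contact_xi : smooth_vf xi;
  almost_contact_eta : smooth_form;
  almost_contact_sqr : forall p x, phi p (phi p x) = - x + eta p x *: xi p;
  almost_contact_dual : forall p, eta p (xi p) = 1
}.

Record almost_contact_norden : Prop := {
  acn_almost_contact : almost_contact;
  acn_metric : pseudo_riemannian;
  acn_norden : forall p x y,
    g p (phi p x) (phi p y) = - g p x y + eta p x * eta p y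
}.

End Tensors.

Section Connections.
Variables (R : realType) (m : nat) (M : smooth_manifold R m).

(* [nabla p v Y] is the covariant derivative at p, along v in T_pM, of a vector
   field Y defined and smooth near p; its value is unconstrained when Y is not
   smooth near p. *)
Variable nabla : M -> 'rV[R]_m -> vfield M -> 'rV[R]_m.

Record affine_connection : Prop := {
  connection_linear : forall p (a : R) u v (Y : vfield M), smooth_vf_at p Y ->
    nabla p (a *: u + v) Y = a *: nabla p u Y + nabla p v Y;
  connection_add : forall p v (Y Z : vfield M),
    smooth_vf_at p Y -> smooth_vf_at p Z ->
    nabla p v (fun q => Y q + Z q) = nabla p v Y + nabla p v Z;
  connection_leibniz : forall p v (f : M -> R) (Y : vfield M),
    smooth_at p f -> smooth_vf_at p Y ->
    nabla p v (fun q => f q *: Y q)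
      = (tderive p v f : R) *: Y p + f p *: nabla p v Y;
  connection_smooth : forall p (X Y : vfield M),
    smooth_vf_at p X -> smooth_vf_at p Y ->
    smooth_vf_at p (fun q => nabla q (X q) Y)
}.

Variable g : M -> {biscalar 'rV[R]_m}.

Record levi_civita : Prop := {
  levi_civita_connection : affine_connection;
  levi_civita_torsion_free : forall p (X Y : vfield M),
    smooth_vf_at p X -> smooth_vf_at p Y ->
    nabla p (X p) Y - nabla p (Y p) X = bracket X Y p;
  levi_civita_metric : forall p v (Y Z : vfield M),
    smooth_vf_at p Y -> smooth_vf_at p Z ->
    tderive p v (fun q => g q (Y q) (Z q) : R)
      = g p (nabla p v Y) (Z p) + g p (Y p) (nabla p v Z)
}.

Definition divergence (X : vfield M) (p : M) : R :=
  \tr (lin1_mx (fun v => nabla p v X)).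

Definition curvature (X Y Z : vfield M) : vfield M := fun p =>
  nabla p (X p) (fun q => nabla q (Y q) Z)
  - nabla p (Y p) (fun q => nabla q (X q) Z)
  - nabla p (bracket X Y p) Z.

Definition curvature4 (X Y Z U : vfield M) (p : M) : R :=
  g p (curvature X Y Z p) (U p).

(* A basis of T_pM, extended to vector fields smooth near p in an arbitrary
   way. *)
Definition frame_at (p : M) (e : 'I_m -> vfield M) : Prop :=
  (forall i, smooth_vf_at p (e i)) /\ (\matrix_i e i p) \in unitmx.

Definition inv_gram (e : 'I_m -> vfield M) (p : M) : 'M[R]_m :=
  invmx (\matrix_(i, j) g p (e i p) (e j p)).

Definition ricci (e : 'I_m -> vfield M) (Y Z : vfield M) (p : M) : R :=
  \sum_i \sum_j inv_gram e p i j * curvature4 (e i) Y Z (e j) p.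

Definition scalar_curvature (e : 'I_m -> vfield M) (p : M) : R :=
  \sum_i \sum_j inv_gram e p i j * ricci e (e i) (e j) p.

Variable phi : M -> {linear 'rV[R]_m -> 'rV[R]_m}.

Definition scalar_curvature_star2 (e : 'I_m -> vfield M) (p : M) : R :=
  \sum_i \sum_j \sum_k \sum_s inv_gram e p i s * inv_gram e p j k *
    curvature4 (e i) (e j) (fun q => phi q (e k q)) (fun q => phi q (e s q)) p.

Definition Ften (X Y Z : vfield M) (p : M) : R :=
  g p (nabla p (X p) (fun q => phi q (Y q)) - phi p (nabla p (X p) Y)) (Z p).

Variables (xi : vfield M) (eta : M -> {scalar 'rV[R]_m}).

Definition omega (X : vfield M) (p : M) : R := Ften xi xi X p.

Definition class_F11 : Prop := forall p (X Y Z : vfield M),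
  smooth_vf_at p X -> smooth_vf_at p Y -> smooth_vf_at p Z ->
  Ften X Y Z p
    = eta p (X p) * (eta p (Y p) * omega Z p + eta p (Z p) * omega Y p).

End Connections.

(* Main.v *)
Require Import Defs.
From HB Require Import structures.
From mathcomp Require Import all_boot all_order all_algebra.
From mathcomp Require Import all_classical all_reals all_analysis.
From mathcomp Require Import ring lra.

(** Write W = phi Omega and D x = nabla_x W, and let a be the 1-form g(W, -).
    By nondegeneracy of g the F_11 condition is an explicit formula for the
    derivative of phi,
      nabla_v (phi Y) = phi (nabla_v Y) + eta(v) (eta(Y) Omega + g(Y, Omega) xi)
    (F11_nabla_phi), and Y = xi turns it into nabla_v xi = eta(v) W
    (F11_nabla_xi).  Differentiating once more gives
      R(x, y) xi = eta(y) D x - eta(x) D y + (eta(x) a(y) - eta(y) a(x)) W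
    (F11_curvature_xi), and commuting R(x, y) with phi gives
      R(x, y, phi z, phi u) + R(x, y, z, u)
        = - eta(u) g(R(x, y) xi, z)
          + (eta(x) a(y) - eta(y) a(x)) eta(z) a(u)
          + eta(y) eta(z) g(D x, u) - eta(x) eta(z) g(D y, u)
    (F11_curvature_phi).  Hence rho(xi, xi) and tau + tau** are metric traces
    of expressions in eta, a and D alone.  Two rules evaluate such traces: the
    trace of f(x) g(v, y) is f(v) for a 1-form f (metric_trace_dual), and that
    of g(L x, y) is the usual trace of L (metric_trace_endo).  As eta(xi) = 1,
    eta(W) = a(xi) = 0 and eta(D xi) = - g(W, W), the last being
    F11_nabla_xi_W, everything but tr D cancels: rho(xi, xi) = tr D = div W, and
    tau + tau** = 2 tr D.

    What makes this more than algebra is that second covariant derivatives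
    need first-order identities at all points near p, for fields that are only
    smooth near p.  Smoothness at p must therefore propagate to nearby points,
    although the chart in which it is tested changes with the point
    (smooth_vf_near); nabla must depend only on the germ of the
    differentiated field (nabla_eq); and the commutation of R(x, y) with phi
    brings in g(R(x, y) z, xi), which is turned into - g(z, R(x, y) xi) by the
    skew-symmetry of the curvature (curvature_skew).  The latter rests on
    [X, Y] f = X (Y f) - Y (X f), hence on the symmetry of second derivatives
    (derive_swap). *)

Set Implicit Arguments.
Unset Strict Implicit.
Unset Printing Implicit Defensive.

Import Order.TTheory GRing.Theory Num.Theory.
Local Open Scope classical_set_scope.
Local Open Scope ring_scope.

(** * Calculus of smooth maps between normed spaces *)

Section Calculus.
Variable R : realType.
Implicit Types V W Z : normedModType R.

Lemma open_setI_preimage (T T' : topologicalType) (A : set T) (B : set T')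
    (f : T -> T') :
  open A -> (forall a, A a -> {for a, continuous f}) -> open B ->
  open (A `&` f @^-1` B).
Proof.
move=> oA cf oB; rewrite openE => a [Aa Bfa]; rewrite /interior.
apply: filterI; first exact: open_nbhs_nbhs.
by apply: cf => //; exact: open_nbhs_nbhs.
Qed.

(** Near [a] the two functions have the same first-order expansion, and that
    expansion determines the differential. *)
Lemma near_eq_differentiable V W (f h : V -> W) (a : V) :
  {near a, f =1 h} -> differentiable f a -> differentiable h a.
Proof.
move=> fh df; have fha : f a = h a by exact: (nbhs_singleton fh).
have cf := diff_continuous df.
have fhE : h \o shift a = cst (h a) + 'd f a +o_ (0 : V) id.
  have /eqaddoP fE := diff_locally df.
  apply/eqaddoP => e e0; move: fh; rewrite (near_shift 0) subr0 => fh.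
  apply: filterS2 fh (fE e e0) => x /=.
  by rewrite /shift/= -fha !fctE /= => ->.
have dE : 'd h a = 'd f a :> (V -> W) by exact: diff_unique.
by apply/diff_locallyP; rewrite dE.
Qed.

Lemma scale_is_bilinear W : bilinear_for
    (GRing.Scale.Law.clone _ _ *:%R _) (GRing.Scale.Law.clone _ _ *:%R _)
    (@GRing.scale R W : R -> W -> W).
Proof.
split=> [u'|u] a x y /=.
- by rewrite scalerDl scalerA.
- by rewrite scalerDr !scalerA mulrC.
Qed.

(** The Leibniz rule, as the chain rule through the continuous bilinear map
    [*:%R]. *)
Lemma is_diff_scale V W (f : V -> R) (h : V -> W) a :
  differentiable f a -> differentiable h a ->
  is_diff a (fun x => f x *: h x)
    (fun v => f a *: 'd h a v + 'd f a v *: h a).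
Proof.
move=> df dh.
pose bM := bilinear_isBilinear.Build R R W W _ _ (@GRing.scale R W)
  (@scale_is_bilinear W).
pose b : {bilinear R -> W -> W} := HB.pack (@GRing.scale R W : R -> W -> W) bM.
have bc : continuous (fun p : R * W => b p.1 p.2) by exact: scale_continuous.
have dp := differentiable_pair df dh.
rewrite (_ : (fun x => _ *: _) =
  (fun p => b p.1 p.2) \o (fun x => (f x, h x)))//.
have db p : differentiable (fun p => b p.1 p.2) p.
  exact: differentiable_bilin.
apply: DiffDef; first exact: differentiable_comp.
by rewrite diff_comp// diff_bilin// diff_pair.
Qed.

Section Ck.
Variables (V W : normedModType R).

Lemma Ck_on_eq k (U : set V) (f h : V -> W) : open U ->
  (forall a, U a -> f a = h a) -> Ck_on U k f -> Ck_on U k h.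
Proof.
move=> oU; elim: k f h => [|k IH] f h fh /=.
  move=> cf a Ua; have na : \forall x \near a, f x = h x.
    by near=> x; apply: fh; near: x; exact: open_nbhs_nbhs.
  rewrite /prop_for /continuous_at -(fh a Ua).
  by apply: cvg_trans (cf a Ua); exact: near_eq_cvg.
have na a : U a -> \forall x \near a, f x = h x.
  by move=> Ua; near=> x; apply: fh; near: x; exact: open_nbhs_nbhs.
move=> [df Df]; split => [a Ua|v].
  by apply: near_eq_differentiable (df a Ua); exact: na.
apply: IH (Df v) => a Ua; apply: near_eq_derive; exact: na.
Unshelve. all: by end_near. Qed.

Lemma Ck_on_sub k (U U' : set V) (f : V -> W) : U `<=` U' ->
  Ck_on U' k f -> Ck_on U k f.
Proof.
move=> UU'; elim: k f => [|k IH] f /=; first by move=> h a /UU' /h.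
by move=> [df Df]; split => [a /UU' /df//|v]; exact: IH.
Qed.

Lemma Ck_onS k (U : set V) (f : V -> W) : Ck_on U k.+1 f -> Ck_on U k f.
Proof.
elim: k f => [|k IH] f /= [df Df].
  by move=> a /df; exact: differentiable_continuous.
by split => // v; exact/IH/Df.
Qed.

Lemma Ck_on_cst k (U : set V) (c : W) : Ck_on U k (cst c).
Proof.
elim: k c => [|k IH] c /=; first by move=> a _; exact: cst_continuous.
split => [a _|v]; first exact: differentiable_cst.
by rewrite (_ : 'D_v _ = cst 0)//; apply/funext => a; rewrite derive_cst.
Qed.

Lemma Ck_onD k (U : set V) (f h : V -> W) : open U ->
  Ck_on U k f -> Ck_on U k h -> Ck_on U k (fun x => f x + h x).
Proof.
move=> oU; elim: k f h => [|k IH] f h /=.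
  by move=> cf ch a Ua; apply: continuousD; [exact: cf|exact: ch].
move=> [df Df] [dh Dh]; split => [a Ua|v].
  by apply: differentiableD; [exact: df|exact: dh].
apply: Ck_on_eq (IH _ _ (Df v) (Dh v)) => // a Ua.
by rewrite -deriveD//; apply: diff_derivable; [exact: df|exact: dh].
Qed.

Lemma Ck_on_sum k (U : set V) n (f : 'I_n -> V -> W) : open U ->
  (forall i, Ck_on U k (f i)) -> Ck_on U k (fun x => \sum_i f i x).
Proof.
move=> oU; elim: n f => [|n IH] f cf.
  by under eq_fun do rewrite big_ord0; exact: Ck_on_cst.
by under eq_fun do rewrite big_ord_recl; apply: Ck_onD => //; exact: IH.
Qed.

End Ck.

Lemma Ck_on_scale V W k (U : set V) (f : V -> R) (h : V -> W) : open U ->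
  Ck_on U k f -> Ck_on U k h -> Ck_on U k (fun x => f x *: h x).
Proof.
move=> oU; elim: k f h => [|k IH] f h.
  move=> /= cf ch a Ua; apply: continuousZ; [exact: cf|exact: ch].
move=> cf ch; have [df Df] := cf; have [dh Dh] := ch; split => [a Ua|v].
  exact: (@ex_diff _ _ _ _ _ _ _ (is_diff_scale (df a Ua) (dh a Ua))).
apply: (@Ck_on_eq _ _ _ _ (fun x => f x *: 'D_v h x + 'D_v f x *: h x)) => //.
  move=> a Ua; have D := is_diff_scale (df a Ua) (dh a Ua).
  rewrite [RHS]deriveE; last exact: (@ex_diff _ _ _ _ _ _ _ D).
  by rewrite (@diff_val _ _ _ _ _ _ _ D) !deriveE//; [exact: df|exact: dh].
apply: Ck_onD => //; first exact: IH (Ck_onS cf) (Dh v).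
exact: IH (Df v) (Ck_onS ch).
Qed.

Lemma derive_row_sum n W (f : 'rV[R]_n -> W) a (w : 'rV[R]_n) :
  differentiable f a -> 'D_w f a = \sum_i w 0 i *: 'D_('e_i) f a.
Proof.
move=> df; rewrite deriveE// {1}(row_sum_delta w) linear_sum.
by apply: eq_bigr => i _; rewrite linearZ/= deriveE.
Qed.

Lemma Ck_on_coord V n k (U : set V) (f : V -> 'rV[R]_n) i : open U ->
  Ck_on U k f -> Ck_on U k (fun x => f x 0 i : R).
Proof.
move=> oU; elim: k f => [|k IH] f /=.
  move=> cf a Ua; apply: (@continuous_comp _ _ _ f (fun M : 'rV[R]_n => M 0 i)).
    exact: cf.
  exact: coord_continuous.
move=> [df Df]; split => [a Ua|v].
  apply: (@differentiable_comp _ _ _ _ f (fun M : 'rV[R]_n => M 0 i : R)).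
    exact: df.
  exact: differentiable_coord.
apply: Ck_on_eq (IH _ (Df v)) => // a Ua.
by rewrite derive_mx ?mxE//; exact/diff_derivable/df.
Qed.

Lemma derive_comp V n W (f : V -> 'rV[R]_n) (h : 'rV[R]_n -> W) a v :
  differentiable f a -> differentiable h (f a) ->
  'D_v (h \o f) a = 'D_('D_v f a) h (f a).
Proof.
move=> df dh; rewrite [LHS]deriveE; last exact: differentiable_comp.
by rewrite diff_comp//= !deriveE.
Qed.

(** The chain rule writes a directional derivative of [h \o f] as a finite
    combination of the partial derivatives of [h] along [f], weighted by the
    components of a derivative of [f], so that smoothness follows by induction
    on the order. *)
Lemma Ck_on_comp V n W k (U : set V) (U' : set 'rV[R]_n) (f : V -> 'rV[R]_n)
    (h : 'rV[R]_n -> W) : open U -> (forall a, U a -> U' (f a)) ->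
  Ck_on U k f -> Ck_on U' k h -> Ck_on U k (h \o f).
Proof.
move=> oU UU'; elim: k h => [|k IH] h.
  move=> /= cf ch a Ua.
  by apply: continuous_comp; [exact: cf|exact: ch (UU' _ Ua)].
move=> cf [dh Dh]; have [df Df] := cf; split => [a Ua|v].
  by apply: differentiable_comp; [exact: df|exact: dh (UU' _ Ua)].
apply: (@Ck_on_eq _ _ _ _
  (fun a => \sum_i 'D_v f a 0 i *: 'D_('e_i) h (f a))) => //.
  move=> a Ua; rewrite derive_comp; [|exact: df|exact: dh (UU' _ Ua)].
  by rewrite [RHS]derive_row_sum//; exact: dh (UU' _ Ua).
apply: Ck_on_sum => // i; apply: Ck_on_scale => //.
  exact: Ck_on_coord (Df v).
exact: (IH ('D_('e_i) h) (Ck_onS cf) (Dh 'e_i)).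
Qed.

Lemma MVT_line V (f : V -> R) (b w : V) (h : R) : 0 < h ->
  (forall s, 0 <= s <= h -> differentiable f (b + s *: w)) ->
  exists2 c, 0 < c < h & f (b + h *: w) - f b = h * 'D_w f (b + c *: w).
Proof.
move=> h0 df.
have lineD s : is_diff s (fun t : R => b + t *: w) (fun t : R => t *: w).
  by have := is_diffD (is_diff_cst b s) (is_diff_scalel s w); rewrite add0r.
have fD s : 0 <= s <= h ->
    is_derive s 1 (fun t : R => f (b + t *: w)) ('D_w f (b + s *: w)).
  move=> sh.
  have dc : differentiable (f \o (fun t : R => b + t *: w)) s.
    by apply: differentiable_comp => //; exact: df.
  apply: DeriveDef; first exact: diff_derivable.
  rewrite (deriveE _ dc) diff_comp//=; last exact: df.
  by rewrite diff_val scale1r deriveE//; exact: df.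
have fD' s : s \in `]0, h[%R ->
    is_derive s 1 (fun t : R => f (b + t *: w)) ('D_w f (b + s *: w)).
  by rewrite in_itv/= => /andP[/ltW s0 /ltW sh]; apply: fD; rewrite s0.
have fc : {within `[0, h], continuous (fun t : R => f (b + t *: w))}.
  apply: continuous_in_subspaceT => s; rewrite inE/= in_itv/= => sh.
  apply: differentiable_continuous; apply/derivable1_diffP.
  by have := fD s sh => -[].
have [c ch fE] := MVT h0 fD' fc.
exists c; first by move: ch; rewrite in_itv.
by move: fE; rewrite scale0r addr0 subr0 mulrC.
Qed.

(** The mean value theorem applied twice: along [u] to the increment of [f] in
    the direction [v], then along [v] to the derivative of [f] in the direction
    [u]. *)
Lemma second_difference V (f : V -> R) (a u v : V) (h : R) : 0 < h ->
  (forall s t, 0 <= s <= h -> 0 <= t <= h ->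
    differentiable f (a + s *: u + t *: v) /\
    differentiable ('D_u f) (a + s *: u + t *: v)) ->
  exists c d, [/\ 0 < c < h, 0 < d < h &
    f (a + h *: u + h *: v) - f (a + h *: u) - (f (a + h *: v) - f a)
      = h * (h * 'D_v ('D_u f) (a + c *: u + d *: v))].
Proof.
move=> h0 df.
have hh : 0 <= h <= h by rewrite (ltW h0) lexx.
have h00 : (0 : R) <= 0 <= h by rewrite lexx ltW.
pose F x := f (x + h *: v) - f x.
have trD x : is_diff x (fun y : V => y + h *: v) id.
  by have := is_diffD (is_diff_id x) (is_diff_cst (h *: v) x); rewrite addr0.
have FD s : 0 <= s <= h -> is_diff (a + s *: u) F
    (fun w => 'D_w f (a + s *: u + h *: v) - 'D_w f (a + s *: u)).
  move=> sh; have [d1 _] := df s h sh hh; have [d2 _] := df s 0 sh h00.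
  rewrite scale0r addr0 in d2.
  have dc : differentiable (f \o (fun y : V => y + h *: v)) (a + s *: u).
    exact: differentiable_comp.
  apply: DiffDef; first exact: (differentiableB dc d2).
  rewrite (diffB dc d2) diff_comp//; apply/funext => w /=.
  by rewrite diff_val !deriveE.
have dF s (sh : 0 <= s <= h) : differentiable F (a + s *: u) :=
  @ex_diff _ _ _ _ _ _ _ (FD s sh).
have [c ch cE] := MVT_line h0 dF.
have cw : 0 <= c <= h by case/andP: ch => /ltW-> /ltW->.
have [d dh dE] := @MVT_line _ ('D_u f) (a + c *: u) v h h0
  (fun t th => proj2 (df c t cw th)).
exists c, d; split => //.
rewrite -dE [_ - f (a + h *: u)](_ : _ = F (a + h *: u))// -/(F a) cE.
by rewrite (deriveE _ (dF c cw)) (@diff_val _ _ _ _ _ _ _ (FD c cw)).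
Qed.

Lemma continuous_ball2 V (P Q : V -> R) (U : set V) (a : V) (e : R) :
  open U -> U a -> 0 < e -> {for a, continuous P} -> {for a, continuous Q} ->
  exists2 r, 0 < r & forall x, `|a - x| < r ->
    [/\ U x, `|P a - P x| < e & `|Q a - Q x| < e].
Proof.
move=> oU Ua e0 /cvgrPdist_lt/(_ _ e0) n1 /cvgrPdist_lt/(_ _ e0) n2.
have nU : nbhs a U by exact: open_nbhs_nbhs.
have : \forall x \near a, [/\ U x, `|P a - P x| < e & `|Q a - Q x| < e].
  near=> x.
  have xU : U x by near: x.
  have x1 : `|P a - P x| < e by near: x.
  have x2 : `|Q a - Q x| < e by near: x.
  by split.
move=> /nbhs_ballP[r /= r0 rB]; exists r => // x xr.
by apply: rB; rewrite -ball_normE.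
Unshelve. all: by end_near. Qed.

Lemma ler_dist_half (x y z e : R) :
  `|x - z| < e / 2 -> `|y - z| < e / 2 -> `|x - y| <= e.
Proof.
move=> xz yz; rewrite -(subrKA z) (le_trans (ler_normD _ _))// (splitr e).
by rewrite lerD ?(ltW xz)// distrC ltW.
Qed.

(** The symmetry of second derivatives.  The second difference of [f] over a
    small parallelogram is symmetric in [u] and [v]; it is [h ^+ 2] times either
    mixed derivative at some point of the parallelogram, and both mixed
    derivatives are continuous at [a]. *)
Lemma derive_swap V (f : V -> R) (U : set V) (a u v : V) : open U -> U a ->
  Ck_on U 2 f -> 'D_u ('D_v f) a = 'D_v ('D_u f) a.
Proof.
move=> oU Ua [df Df].
have cD w z : {for a, continuous ('D_w ('D_z f))}.
  by have [_ /(_ w) /=] := Df z; exact.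
apply/eqP; rewrite -subr_eq0 -normr_le0.
apply/ler_addgt0Pl => e e0; rewrite addr0.
have e20 : 0 < e / 2 by rewrite divr_gt0.
pose B x := [/\ U x, `|'D_u ('D_v f) a - 'D_u ('D_v f) x| < e / 2 &
  `|'D_v ('D_u f) a - 'D_v ('D_u f) x| < e / 2].
have [r r0 rB] : exists2 r, 0 < r & forall x, `|a - x| < r -> B x.
  exact: continuous_ball2.
pose k := 1 + `|u| + `|v|.
have k0 : 0 < k by rewrite /k -addrA ltr_wpDr// addr_ge0.
(* this size keeps the parallelogram inside the ball of radius [r] around [a] *)
pose h := r / k / 2; have h0 : 0 < h by rewrite !divr_gt0.
have inB s t : 0 <= s <= h -> 0 <= t <= h -> B (a + s *: u + t *: v).
  move=> /andP[s0 sh] /andP[t0 th]; apply: rB.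
  rewrite -addrA opprD addNKr normrN.
  rewrite (le_lt_trans (ler_normD _ _))// !normrZ (ger0_norm s0) (ger0_norm t0).
  have -> : r = h * k + h * k by rewrite /h; field; rewrite gt_eqF.
  apply: (@le_lt_trans _ _ (h * `|u| + h * `|v|)).
    by rewrite lerD// ler_wpM2r.
  rewrite -mulrDr -mulrDr ltr_pM2l// /k.
  by have := normr_ge0 u; have := normr_ge0 v; lra.
have sw s t : a + s *: v + t *: u = a + t *: u + s *: v by rewrite addrAC.
have [c [d [ch dh E1]]] := @second_difference _ f a u v h h0
  (fun s t sh th => let: And3 Ux _ _ := inB s t sh th in
     conj (df _ Ux) (proj1 (Df u) _ Ux)).
have [c' [d' [ch' dh' E2]]] : exists c d, [/\ 0 < c < h, 0 < d < h &
    f (a + h *: v + h *: u) - f (a + h *: v) - (f (a + h *: u) - f a)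
      = h * (h * 'D_u ('D_v f) (a + c *: v + d *: u))].
  apply: second_difference => // s t sh th; rewrite sw.
  by have [Ux _ _] := inB t s th sh; split; [exact: df|exact: (proj1 (Df v))].
have W x y : 0 < x < h -> 0 < y < h -> B (a + x *: u + y *: v).
  move=> /andP[/ltW x0 /ltW xh] /andP[/ltW y0 /ltW yh].
  by apply: inB; apply/andP.
have [_ _ B1] := W _ _ ch dh; have [_ B2 _] := W _ _ dh' ch'.
have E : 'D_v ('D_u f) (a + c *: u + d *: v)
    = 'D_u ('D_v f) (a + d' *: u + c' *: v).
  have hn0 : h != 0 by rewrite gt_eqF.
  apply: (mulfI hn0); apply: (mulfI hn0).
  rewrite (sw c' d') (sw h h) in E2; rewrite -E1 -E2.
  move: (f (a + h *: u + h *: v)) (f (a + h *: u)) (f (a + h *: v)) (f a).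
  by move=> w x y z; ring.
by rewrite E in B1; exact: ler_dist_half B2 B1.
Qed.

End Calculus.

(** * Tangent vectors and vector fields in charts *)

Section SmoothOn.
Variable R : realType.
Implicit Types V W : normedModType R.

Lemma smooth_on_differentiable V W (U : set V) (f : V -> W) a :
  smooth_on U f -> U a -> differentiable f a.
Proof. by move=> /(_ 1%N)[df _]; exact: df. Qed.

Lemma smooth_on_derive V W (U : set V) (f : V -> W) v :
  smooth_on U f -> smooth_on U ('D_v f).
Proof. by move=> sf k; have [_] := sf k.+1; exact. Qed.

Lemma smooth_on_sub V W (U U' : set V) (f : V -> W) :
  U `<=` U' -> smooth_on U' f -> smooth_on U f.
Proof. by move=> UU' sf k; exact: Ck_on_sub (sf k). Qed.

Lemma smooth_on_eq V W (U : set V) (f h : V -> W) : open U ->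
  (forall a, U a -> f a = h a) -> smooth_on U f -> smooth_on U h.
Proof. by move=> oU fh sf k; exact: Ck_on_eq (sf k). Qed.

Lemma smooth_on_comp V n W (U : set V) (U' : set 'rV[R]_n) (f : V -> 'rV[R]_n)
    (h : 'rV[R]_n -> W) : open U -> (forall a, U a -> U' (f a)) ->
  smooth_on U f -> smooth_on U' h -> smooth_on U (h \o f).
Proof. by move=> oU UU' sf sh k; apply: Ck_on_comp (sf k) (sh k). Qed.

Lemma smooth_on_derive_along n W (U : set 'rV[R]_n)
    (w : 'rV[R]_n -> 'rV[R]_n) (f : 'rV[R]_n -> W) : open U ->
  smooth_on U w -> smooth_on U f -> smooth_on U (fun a => 'D_(w a) f a).
Proof.
move=> oU sw sf; apply: (@smooth_on_eq _ _ _
  (fun a => \sum_i w a 0 i *: 'D_('e_i) f a)) => // [a Ua|k].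
  by rewrite [RHS]derive_row_sum//; exact: smooth_on_differentiable sf Ua.
apply: Ck_on_sum => // i; apply: Ck_on_scale => //.
  exact: Ck_on_coord (sw k).
exact: smooth_on_derive.
Qed.

(** The second summand is the second derivative of [f] with the direction [w a]
    frozen; the first one accounts for the variation of the direction. *)
Lemma derive_derive_along n (U : set 'rV[R]_n) (w : 'rV[R]_n -> 'rV[R]_n)
    (f : 'rV[R]_n -> R) a u : open U -> U a ->
  smooth_on U w -> smooth_on U f ->
  'D_u (fun x => 'D_(w x) f x) a = 'D_('D_u w a) f a + 'D_(w a) ('D_u f) a.
Proof.
move=> oU Ua sw sf.
have dw := smooth_on_differentiable sw Ua.
have df v x := smooth_on_differentiable (smooth_on_derive v sf) (a := x).
have dc i : differentiable (fun x => w x 0 i : R) a.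
  by have [] := Ck_on_coord i oU (sw 1%N) => + _; apply.
pose F i x := w x 0 i *: 'D_('e_i) f x.
rewrite (@near_eq_derive _ _ _ _ (\sum_i F i)); last first.
  near=> x; rewrite fct_sumE derive_row_sum//.
  by apply: (smooth_on_differentiable sf); near: x; exact: open_nbhs_nbhs.
have FD i := is_diff_scale (dc i) (df 'e_i a Ua).
have dF i : differentiable (F i) a := @ex_diff _ _ _ _ _ _ _ (FD i).
rewrite derive_sum; last by move=> i; exact: diff_derivable.
rewrite [X in _ = X + _]derive_row_sum; last first.
  exact: smooth_on_differentiable sf Ua.
rewrite [X in _ = _ + X]derive_row_sum; last exact: df.
rewrite -big_split/=; apply: eq_bigr => i _.
rewrite (deriveE _ (dF i)) (@diff_val _ _ _ _ _ _ _ (FD i)) -!deriveE//.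
  2: exact: df.
rewrite (derive_swap u 'e_i oU Ua (sf 2%N)) derive_mx ?mxE 1?addrC//.
exact: diff_derivable.
Unshelve. all: by end_near. Qed.

End SmoothOn.

Section Charts.
Variables (R : realType) (m : nat) (M : smooth_manifold R m).
Implicit Types (p q r : M) (W : normedModType R) (X Y : vfield M).

Definition transition p q : 'rV[R]_m -> 'rV[R]_m := chart q \o chart_inv p.

Definition overlap p q : set 'rV[R]_m :=
  chart p @` (chart_dom p `&` chart_dom q).

Lemma chart_dom_refl p : chart_dom p p.
Proof. by have [] := chart_dom_nbhs p. Qed.

Lemma near_chart_dom p q : chart_dom p q -> \forall r \near q, chart_dom p r.
Proof.
by move=> pq; apply: open_nbhs_nbhs; split => //; case: (chart_dom_nbhs p).
Qed.

Lemma overlap_chart p q r : chart_dom p r -> chart_dom q r ->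
  overlap p q (chart p r).
Proof. by move=> pr qr; exists r. Qed.

Lemma transitionE p q r : chart_dom p r ->
  transition p q (chart p r) = chart q r.
Proof. by move=> pr; rewrite /transition/= chartK. Qed.

Lemma open_overlap p q : open (overlap p q).
Proof.
have -> : overlap p q =
    (chart p @` chart_dom p) `&` chart_inv p @^-1` (chart_dom q).
  apply/seteqP; split => [_ [r [pr qr] <-]|_ [[r pr <-] /=]].
    by split => /=; [exists r|rewrite chartK].
  by rewrite chartK// => qr; exists r.
apply: open_setI_preimage; first exact: chart_open.
  exact: chart_inv_continuous.
by case: (chart_dom_nbhs q).
Qed.

Lemma transition_smooth p q : smooth_on (overlap p q) (transition p q).
Proof. exact: chart_smooth. Qed.

Lemma transition_differentiable p q r : chart_dom p r -> chart_dom q r ->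
  differentiable (transition p q) (chart p r).
Proof.
move=> pr qr; apply: (smooth_on_differentiable (@transition_smooth p q)).
exact: overlap_chart.
Qed.

Lemma near_chart p q (A : set 'rV[R]_m) : chart_dom p q -> nbhs (chart p q) A ->
  \forall r \near q, A (chart p r).
Proof. by move=> pq; exact: chart_continuous. Qed.

Lemma near_chart_inv p (P : set M) : (\near p, P p) ->
  \forall a \near chart p p, P (chart_inv p a).
Proof.
move=> nP; have pp := chart_dom_refl p.
have : chart_inv p x @[x --> chart p p] --> chart_inv p (chart p p).
  by apply: chart_inv_continuous; exists p.
by rewrite chartK//; apply.
Qed.

Lemma near_overlap p q r : chart_dom p r -> chart_dom q r ->
  \forall a \near chart p r, overlap p q a.
Proof.
move=> pr qr; apply: open_nbhs_nbhs; split; first exact: open_overlap.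
exact: overlap_chart.
Qed.

(** Smoothness at [q], which is defined in the chart of [q], may be checked in
    any chart around [q]. *)
Lemma smooth_at_chart p q W (A : set 'rV[R]_m) (f : M -> W) :
  chart_dom p q -> open A -> A (chart p q) ->
  smooth_on A (f \o chart_inv p) -> smooth_at q f.
Proof.
move=> pq oA Aq sf; have qq := chart_dom_refl q.
have oI : open (overlap q p `&` transition q p @^-1` A).
  apply: open_setI_preimage => //; first exact: open_overlap.
  exact: (@transition_smooth q p 0%N).
exists (overlap q p `&` transition q p @^-1` A).
  by split => //; split; [exact: overlap_chart|rewrite /= transitionE].
apply: (@smooth_on_eq _ _ _ _ ((f \o chart_inv p) \o transition q p)) => //.
  by move=> _ [[r [qr pr] <-] _]; rewrite /= transitionE// !chartK.
apply: (smooth_on_comp oI _ _ sf) => [a []//|].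
by apply: smooth_on_sub (@transition_smooth q p) => a [].
Qed.

Lemma smooth_at_eq p W (f h : M -> W) : (\forall q \near p, f q = h q) ->
  smooth_at p f -> smooth_at p h.
Proof.
move=> /near_chart_inv Bp [U [oU Up] sf].
pose B := [set a | f (chart_inv p a) = h (chart_inv p a)]^°.
have oB : open B by exact: open_interior.
have BP := @interior_subset _ [set a | f (chart_inv p a) = h (chart_inv p a)].
exists (U `&` B); first by split; [exact: openI|].
apply: (smooth_on_eq (openI oU oB) _ (smooth_on_sub _ sf)) => [a [_ /BP]//|].
by move=> a [].
Qed.

Lemma smooth_at_cst p W (c : W) : smooth_at p (fun _ => c).
Proof.
exists setT; first by split => //; exact: openT.
by move=> k; exact: Ck_on_cst.
Qed.

Lemma smooth_atD p W (f h : M -> W) : smooth_at p f -> smooth_at p h ->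
  smooth_at p (fun q => f q + h q).
Proof.
move=> [U [oU Up] sf] [U' [oU' U'p] sh]; exists (U `&` U').
  by split => //; exact: openI.
move=> k; apply: (@Ck_onD _ _ _ _ _ (f \o chart_inv p) (h \o chart_inv p)).
- exact: openI.
- by apply: Ck_on_sub (sf k) => a [].
- by apply: Ck_on_sub (sh k) => a [].
Qed.

Lemma smooth_at_scale p W (f : M -> R) (h : M -> W) : smooth_at p f ->
  smooth_at p h -> smooth_at p (fun q => f q *: h q).
Proof.
move=> [U [oU Up] sf] [U' [oU' U'p] sh]; exists (U `&` U').
  by split => //; exact: openI.
move=> k; apply: (@Ck_on_scale _ _ _ _ _ (f \o chart_inv p) (h \o chart_inv p)).
- exact: openI.
- by apply: Ck_on_sub (sf k) => a [].
- by apply: Ck_on_sub (sh k) => a [].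
Qed.

Lemma smooth_at_differentiable p W (f : M -> W) : smooth_at p f ->
  differentiable (f \o chart_inv p) (chart p p).
Proof. by move=> [U [oU Up] sf]; exact: smooth_on_differentiable sf Up. Qed.

Lemma tderive_eq p v W (f h : M -> W) : (\forall q \near p, f q = h q) ->
  tderive p v f = tderive p v h.
Proof. by move=> /near_chart_inv fh; exact: near_eq_derive fh. Qed.

Lemma tderive_cst p v W (c : W) : tderive p v (fun _ => c) = 0.
Proof. by rewrite /tderive (_ : _ \o _ = cst c)// derive_cst. Qed.

Lemma tderiveD p v W (f h : M -> W) : smooth_at p f -> smooth_at p h ->
  tderive p v (fun q => f q + h q) = tderive p v f + tderive p v h.
Proof.
move=> /smooth_at_differentiable df /smooth_at_differentiable dh.
rewrite /tderive -deriveD//; exact: diff_derivable.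
Qed.

Lemma tderive_linear p a u v W (f : M -> W) : smooth_at p f ->
  tderive p (a *: u + v) f = a *: tderive p u f + tderive p v f.
Proof.
by move=> /smooth_at_differentiable df; rewrite /tderive !deriveE// linearP.
Qed.

(** The chain rule for the change of charts: the derivative along a tangent
    vector at [q], given by its components in the chart of [q], is computed in
    the chart of [p] from its components there. *)
Lemma tderive_chart p q v W (f : M -> W) : chart_dom p q ->
  differentiable (f \o chart_inv p) (chart p q) ->
  tderive q v f = 'D_(tderive q v (chart p)) (f \o chart_inv p) (chart p q).
Proof.
move=> pq df; have qq := chart_dom_refl q.
have E : transition q p (chart q q) = chart p q by rewrite transitionE.
rewrite {2}/tderive -/(transition q p) -[in RHS]E -derive_comp; last 2 first.
- exact: transition_differentiable.
- by rewrite E.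
apply: near_eq_derive; near=> a.
have [r [qr pr] <-] : overlap q p a by near: a; exact: near_overlap.
by rewrite /= transitionE// !chartK.
Unshelve. all: by end_near. Qed.

Lemma tderive_chart_linear p q a u v : chart_dom p q ->
  tderive q (a *: u + v) (chart p)
    = a *: tderive q u (chart p) + tderive q v (chart p).
Proof.
move=> pq; have := transition_differentiable (chart_dom_refl q) pq.
by rewrite /tderive => d; rewrite !deriveE// linearP.
Qed.

Lemma tderive_chart_self p v : tderive p v (chart p) = v.
Proof.
have pp := chart_dom_refl p.
rewrite -[RHS](derive_id (chart p p)); apply: near_eq_derive; near=> a.
have [r [pr _] <-] : overlap p p a by near: a; exact: near_overlap.
by rewrite /= chartK.
Unshelve. all: by end_near. Qed.

Definition components p X : M -> 'rV[R]_m := fun q => tderive q (X q) (chart p).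

(** At a point [q] near [p], the components of [X] in the chart of [q] are the
    derivative of the change of charts along the components of [X] in the chart
    of [p]. *)
Lemma smooth_vf_near p X : smooth_vf_at p X ->
  \forall q \near p, smooth_vf_at q X.
Proof.
move=> [U [oU Up] sX]; have pp := chart_dom_refl p.
near=> q.
have pq : chart_dom p q by near: q; exact: near_chart_dom.
have Uq : U (chart p q).
  by near: q; apply: near_chart => //; exact: open_nbhs_nbhs.
have qq := chart_dom_refl q.
have oI : open (U `&` overlap p q) by apply: openI => //; exact: open_overlap.
have Iq : (U `&` overlap p q) (chart p q) by split => //; exact: overlap_chart.
suff sc : smooth_on (U `&` overlap p q) (components q X \o chart_inv p).
  exact: smooth_at_chart pq oI Iq sc.
pose D a := 'D_((components p X \o chart_inv p) a) (transition p q) a.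
have DE a : (U `&` overlap p q) a -> D a = (components q X \o chart_inv p) a.
  move=> [_ [r [pr qr] <-]]; have tr := transition_differentiable pr qr.
  have cE x : (components x X \o chart_inv p) (chart p r) = components x X r.
    by rewrite /comp chartK.
  by rewrite /D !cE /components (tderive_chart _ pr tr).
apply: (smooth_on_eq oI DE); apply: (smooth_on_derive_along oI).
  by apply: smooth_on_sub sX => a [].
by apply: smooth_on_sub (@transition_smooth p q) => a [].
Unshelve. all: by end_near. Qed.

Lemma smooth_vf_eq p X Y : (\forall q \near p, X q = Y q) ->
  smooth_vf_at p X -> smooth_vf_at p Y.
Proof.
by move=> XY; apply: smooth_at_eq; apply: filterS XY => q ->.
Qed.

Lemma smooth_vfD p X Y : smooth_vf_at p X -> smooth_vf_at p Y ->
  smooth_vf_at p (fun q => X q + Y q).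
Proof.
move=> sX sY; apply: smooth_at_eq (smooth_atD sX sY); near=> q.
have pq : chart_dom p q.
  by near: q; apply: near_chart_dom; exact: chart_dom_refl.
by have := tderive_chart_linear 1 (X q) (Y q) pq; rewrite !scale1r => ->.
Unshelve. all: by end_near. Qed.

Lemma tderive_chart0 p q : tderive q 0 (chart p) = 0.
Proof. by rewrite /tderive derive0. Qed.

Lemma smooth_vf_scale p (f : M -> R) X : smooth_at p f -> smooth_vf_at p X ->
  smooth_vf_at p (fun q => f q *: X q).
Proof.
move=> sf sX; apply: smooth_at_eq (smooth_at_scale sf sX); near=> q.
have pq : chart_dom p q.
  by near: q; apply: near_chart_dom; exact: chart_dom_refl.
have := tderive_chart_linear (f q) (X q) 0 pq.
by rewrite tderive_chart0 !addr0 => ->.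
Unshelve. all: by end_near. Qed.

(** The coordinate field, in the chart of [p], with constant components [v]:
    the derivative of the change of charts brings [v] to the coordinate basis
    in use at each point. *)
Definition constant_extension p v : vfield M :=
  fun q => 'D_v (transition p q) (chart p q).

Lemma constant_extension_components p v q : chart_dom p q ->
  components p (constant_extension p v) q = v.
Proof.
move=> pq; have qq := chart_dom_refl q.
have E : transition p q (chart p q) = chart q q by rewrite transitionE.
rewrite /components /tderive -/(transition q p) -E /constant_extension.
rewrite -derive_comp; last 2 first.
- exact: transition_differentiable.
- by rewrite E; exact: transition_differentiable.
rewrite -[RHS](derive_id (chart p q)); apply: near_eq_derive; near=> a.
have [r [pr qr] <-] : overlap p q a by near: a; exact: near_overlap.
by rewrite /= !transitionE.
Unshelve. all: by end_near. Qed.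

Lemma constant_extension_smooth p v : smooth_vf_at p (constant_extension p v).
Proof.
apply: smooth_at_eq (smooth_at_cst p v); near=> q.
rewrite -[RHS]/(components p _ q) constant_extension_components//; near: q.
by apply: near_chart_dom; exact: chart_dom_refl.
Unshelve. all: by end_near. Qed.

Lemma constant_extension_self p v : constant_extension p v p = v.
Proof.
have pp := chart_dom_refl p.
rewrite -[RHS](constant_extension_components v pp).
by rewrite /components tderive_chart_self.
Qed.

(** In the chart of [p], [X f] differentiates [f] along the components of [X];
    differentiating once more acts both on these components and on the
    derivatives of [f]. *)
Lemma tderive_tderive p X (f : M -> R) u : smooth_vf_at p X -> smooth_at p f ->
  tderive p u (fun q => tderive q (X q) f : R)
    = tderive p (tderive p u (components p X)) f
      + 'D_(X p) ('D_u (f \o chart_inv p)) (chart p p).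
Proof.
move=> [U [oU Up] sX] [U' [oU' U'p] sf]; have pp := chart_dom_refl p.
have oI := openI oU oU'.
have sX' : smooth_on (U `&` U') (components p X \o chart_inv p).
  by apply: smooth_on_sub sX => a [].
have sf' : smooth_on (U `&` U') (f \o chart_inv p).
  by apply: smooth_on_sub sf => a [].
have E := derive_derive_along u oI (conj Up U'p) sX' sf'.
have cE : (components p X \o chart_inv p) (chart p p) = X p.
  by rewrite /comp chartK// /components tderive_chart_self.
rewrite cE in E; apply: etrans E; apply: near_eq_derive.
near=> a.
have : overlap p p a by near: a; exact: near_overlap.
have : U' a by near: a; exact: open_nbhs_nbhs.
move=> /[swap] -[r [pr _] <-] U'r /=; rewrite chartK//.
by apply: tderive_chart => //; exact: smooth_on_differentiable sf U'r.
Unshelve. all: by end_near. Qed.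

(** [X, Y] f = X (Y f) - Y (X f): the two terms of [tderive_tderive] that hold
    second derivatives of [f] cancel by symmetry, and the remaining ones form
    the bracket. *)
Lemma tderive_bracket p X Y (f : M -> R) :
  smooth_vf_at p X -> smooth_vf_at p Y -> smooth_at p f ->
  tderive p (bracket X Y p) f
    = tderive p (X p) (fun q => tderive q (Y q) f : R)
      - tderive p (Y p) (fun q => tderive q (X q) f : R).
Proof.
move=> sX sY sf; have [U [oU Up] sfU] := sf.
rewrite (tderive_tderive (X p) sY sf) (tderive_tderive (Y p) sX sf).
rewrite (derive_swap (X p) (Y p) oU Up (sfU 2%N)).
have cancel (x y z : R) : x + z - (y + z) = x - y by ring.
rewrite cancel /bracket -/(components p Y) -/(components p X).
rewrite addrC -scaleN1r tderive_linear// addrC.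
by rewrite -[in RHS]mulN1r.
Qed.

End Charts.

(** * Connections and curvature *)

Section AffineConnection.
Variables (R : realType) (m : nat) (M : smooth_manifold R m).
Variable nabla : M -> 'rV[R]_m -> vfield M -> 'rV[R]_m.
Hypothesis nabla_affine : affine_connection nabla.
Implicit Types (p q : M) (X Y Z : vfield M).

Lemma nablaZ p v (a : R) Y : smooth_vf_at p Y ->
  nabla p v (fun q => a *: Y q) = a *: nabla p v Y.
Proof.
move=> sY; rewrite (connection_leibniz nabla_affine v (smooth_at_cst p a) sY).
by rewrite tderive_cst scale0r add0r.
Qed.

(** The difference of the two fields vanishes near [p], so it equals its own
    multiple by the indicator function of its support.  That function is zero
    near [p], hence smooth at [p] although possibly discontinuous elsewhere,
    and the Leibniz rule shows that the covariant derivative of the difference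
    is zero. *)
Lemma nabla_eq p v Y Z : smooth_vf_at p Y -> (\forall q \near p, Y q = Z q) ->
  nabla p v Y = nabla p v Z.
Proof.
move=> sY YZ; pose D q := Z q - Y q; pose f q : R := (D q != 0)%:R.
have D0 : \forall q \near p, D q = 0.
  by apply: filterS YZ => q; rewrite /D => ->; rewrite subrr.
have Dp : D p = 0 by exact: nbhs_singleton D0.
have sD : smooth_vf_at p D.
  apply: smooth_vf_eq (smooth_vf_scale (smooth_at_cst p 0) sY).
  by apply: filterS D0 => q ->; rewrite scale0r.
have sf : smooth_at p f.
  apply: smooth_at_eq (smooth_at_cst p 0).
  by apply: filterS D0 => q Dq; rewrite /f Dq eqxx.
have DE : D = (fun q => f q *: D q).
  apply/funext => q; rewrite /f; have [->|_] := eqVneq (D q) 0.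
    by rewrite scaler0.
  by rewrite scale1r.
have nD : nabla p v D = 0.
  rewrite DE (connection_leibniz nabla_affine v sf sD) Dp scaler0 add0r.
  by rewrite /f Dp eqxx scale0r.
have ZE : Z = (fun q => Y q + D q).
  by apply/funext => q; rewrite /D addrC subrK.
by rewrite ZE (connection_add nabla_affine v sY sD) nD addr0.
Qed.

End AffineConnection.

Section LeviCivita.
Variables (R : realType) (m : nat) (M : smooth_manifold R m).
Variable g : M -> {biscalar 'rV[R]_m}.
Variable nabla : M -> 'rV[R]_m -> vfield M -> 'rV[R]_m.
Hypothesis g_metric : pseudo_riemannian g.
Hypothesis nabla_lc : levi_civita nabla g.
Implicit Types (p q : M) (X Y Z U : vfield M).

Let nabla_affine := levi_civita_connection nabla_lc.

Lemma tderive_tderive_metric p X Y Z U :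
  smooth_vf_at p X -> smooth_vf_at p Y -> smooth_vf_at p Z ->
  smooth_vf_at p U ->
  tderive p (X p) (fun q => tderive q (Y q) (fun r => g r (Z r) (U r) : R) : R)
    = g p (nabla p (X p) (fun q => nabla q (Y q) Z)) (U p)
      + g p (nabla p (Y p) Z) (nabla p (X p) U)
      + (g p (nabla p (X p) Z) (nabla p (Y p) U)
      + g p (Z p) (nabla p (X p) (fun q => nabla q (Y q) U))).
Proof.
move=> sX sY sZ sU.
have sYZ := connection_smooth nabla_affine sY sZ.
have sYU := connection_smooth nabla_affine sY sU.
rewrite -(levi_civita_metric nabla_lc (X p) sYZ sU).
rewrite -(levi_civita_metric nabla_lc (X p) sZ sYU).
rewrite -tderiveD; [|exact: metric_smooth g_metric _ _ _ sYZ sU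
                    |exact: metric_smooth g_metric _ _ _ sZ sYU].
apply: tderive_eq; near=> q; apply: (levi_civita_metric nabla_lc).
  by near: q; exact: smooth_vf_near.
by near: q; exact: smooth_vf_near.
Unshelve. all: by end_near. Qed.

(** [X, Y] acts on the function g(Z, U) as the commutator of [X] and [Y]; after
    expansion by metric compatibility, the products of first covariant
    derivatives are symmetric in [X] and [Y] and cancel. *)
Lemma curvature_skew p X Y Z U :
  smooth_vf_at p X -> smooth_vf_at p Y -> smooth_vf_at p Z ->
  smooth_vf_at p U ->
  g p (curvature nabla X Y Z p) (U p) = - g p (Z p) (curvature nabla X Y U p).
Proof.
move=> sX sY sZ sU.
have := tderive_bracket sX sY (metric_smooth g_metric sZ sU).
rewrite (tderive_tderive_metric sX sY sZ sU).
rewrite (tderive_tderive_metric sY sX sZ sU).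
rewrite (levi_civita_metric nabla_lc _ sZ sU) /curvature => E.
rewrite !linearBl !linearBr/=; move: E.
move: (g p (nabla p (bracket X Y p) Z) (U p)) => a E.
have -> : a = a + 0 by rewrite addr0.
rewrite -[0](subrr (g p (Z p) (nabla p (bracket X Y p) U))) addrA E; ring.
Qed.

End LeviCivita.

(** * The curvature of manifolds of class F_11 *)

Section NordenAlgebra.
Variables (R : realType) (m : nat) (M : smooth_manifold R m).
Variables (phi : M -> {linear 'rV[R]_m -> 'rV[R]_m}) (xi : vfield M).
Variables (eta : M -> {scalar 'rV[R]_m}) (g : M -> {biscalar 'rV[R]_m}).
Hypothesis norden : almost_contact_norden phi xi eta g.

Let contact := acn_almost_contact norden.
Let phi2 := almost_contact_sqr contact.
Let eta_xi := almost_contact_dual contact.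

(** Applying phi to [phi (phi xi) = 0] shows that [phi xi = c *: xi]; then
    [c ^+ 2 = 0]. *)
Lemma norden_phi_xi p : phi p (xi p) = 0.
Proof.
have h2 : phi p (phi p (xi p)) = 0 by rewrite phi2 eta_xi scale1r addNr.
have h3 : phi p (xi p) = eta p (phi p (xi p)) *: xi p.
  have := phi2 p (phi p (xi p)); rewrite h2 linear0 => /eqP.
  by rewrite eq_sym addrC subr_eq0 => /eqP.
move: h2; rewrite h3 linearZ/= h3 => /(congr1 (eta p)).
rewrite linear0 !linearZ/= eta_xi mulr1 => /eqP.
by rewrite mulf_eq0 orbb => /eqP ->; rewrite scale0r.
Qed.

Lemma norden_eta_phi p x : eta p (phi p x) = 0.
Proof.
have := phi2 p (phi p x); rewrite (phi2 p x) linearD linearN linearZ/=.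
rewrite norden_phi_xi scaler0 addr0 => /(congr1 (eta p)).
rewrite linearD linearZ/= eta_xi mulr1 linearN addNr => h.
by apply/eqP; rewrite -oppr_eq0 h.
Qed.

Lemma norden_eta p x : eta p x = g p x (xi p).
Proof.
have := acn_norden norden p x (xi p).
rewrite norden_phi_xi linear0r eta_xi mulr1 => /eqP.
by rewrite eq_sym addrC subr_eq0 => /eqP.
Qed.

Lemma norden_phi_sym p x y : g p (phi p x) y = g p x (phi p y).
Proof.
have := acn_norden norden p x (phi p y).
rewrite phi2 linearDr linearNr linearZr_LR/= -norden_eta !norden_eta_phi.
by rewrite !mulr0 !addr0 => /oppr_inj.
Qed.

End NordenAlgebra.

Section F11.
Variables (R : realType) (m : nat) (M : smooth_manifold R m).
Variables (phi : M -> {linear 'rV[R]_m -> 'rV[R]_m}) (xi : vfield M).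
Variables (eta : M -> {scalar 'rV[R]_m}) (g : M -> {biscalar 'rV[R]_m}).
Variable nabla : M -> 'rV[R]_m -> vfield M -> 'rV[R]_m.
Variable Omega : vfield M.
Hypothesis norden : almost_contact_norden phi xi eta g.
Hypothesis nabla_lc : levi_civita nabla g.
Hypothesis Omega_smooth : smooth_vf Omega.
Hypothesis omegaE : forall p (X : vfield M), smooth_vf_at p X ->
  omega nabla g phi xi X p = g p (X p) (Omega p).
Hypothesis F11 : class_F11 nabla g phi xi eta.
Implicit Types (p q : M) (X Y Z U : vfield M).

Let contact := acn_almost_contact norden.
Let g_metric := acn_metric norden.
Let nabla_affine := levi_civita_connection nabla_lc.
Let xi_smooth : smooth_vf xi := almost_contact_xi contact.
Let g_sym := Defs.metric_sym g_metric.
Let eta_xi := almost_contact_dual contact.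
Let etaE := norden_eta norden.
Let eta_phi := norden_eta_phi norden.
Let phi_xi := norden_phi_xi norden.
Let phi_sym := norden_phi_sym norden.

Let W : vfield M := fun q => phi q (Omega q).

Let W_smooth : smooth_vf W.
Proof.
by move=> p; apply: (almost_contact_phi contact); exact: Omega_smooth.
Qed.

Let eta_Omega p : eta p (Omega p) = 0.
Proof.
have E : omega nabla g phi xi xi p = eta p (Omega p).
  by rewrite omegaE// g_sym -etaE.
have := F11 (xi_smooth p) (xi_smooth p) (xi_smooth p).
rewrite -/(omega nabla g phi xi xi p) eta_xi !mul1r E => /eqP.
by rewrite -subr_eq0 opprD addNKr oppr_eq0 => /eqP.
Qed.

Let eta_W p : eta p (W p) = 0.
Proof. exact: eta_phi. Qed.

Let gxi p x : g p (xi p) x = eta p x.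
Proof. by rewrite g_sym etaE. Qed.

(** Tangent vectors at [p] are extended to smooth fields in order to use the
    F_11 identity, which is stated for fields; nondegeneracy of [g] then removes
    the third argument. *)
Lemma F11_nabla_phi p v Y : smooth_vf_at p Y ->
  nabla p v (fun q => phi q (Y q)) = phi p (nabla p v Y)
    + eta p v *: (eta p (Y p) *: Omega p + g p (Y p) (Omega p) *: xi p).
Proof.
move=> sY; apply/eqP; rewrite -subr_eq0; apply/eqP.
apply: (@metric_nondegenerate _ _ _ _ g_metric p) => z.
have sX := constant_extension_smooth p v.
have sZ := constant_extension_smooth p z.
have := F11 sX sY sZ; rewrite !omegaE// /Ften !constant_extension_self => E.
rewrite opprD addrA linearDl/= E linearNl linearZl_LR/= linearDl/=.
rewrite !linearZl_LR/= gxi (g_sym _ _ z); ring.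
Qed.

(** For [Y = xi], [F11_nabla_phi] determines the image by phi of the derivative
    of xi; applying phi again recovers that derivative up to its xi-component,
    which vanishes because [g(xi, xi) = 1]. *)
Lemma F11_nabla_xi p v : nabla p v xi = eta p v *: W p.
Proof.
have sxi := xi_smooth p.
have gx : g p (nabla p v xi) (xi p) = 0.
  have := levi_civita_metric nabla_lc v sxi sxi.
  have -> : (fun q => g q (xi q) (xi q)) = (fun _ => 1 : R).
    by apply/funext => q; rewrite -etaE eta_xi.
  rewrite tderive_cst g_sym -mulr2n => /esym/eqP.
  by rewrite mulrn_eq0/= g_sym => /eqP.
have := F11_nabla_phi v sxi.
have -> : (fun q => phi q (xi q)) = (fun q => 0 *: xi q).
  by apply/funext => q; rewrite phi_xi scale0r.
rewrite (nablaZ nabla_affine)// scale0r gxi eta_Omega scale0r addr0 eta_xi.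
rewrite scale1r => /(congr1 (phi p)).
rewrite linear0 linearD linearZ/= (almost_contact_sqr contact) etaE gx scale0r.
by rewrite addr0 => /eqP; rewrite eq_sym addrC subr_eq0 => /eqP.
Qed.

Lemma tderive_eta p v Y : smooth_vf_at p Y ->
  tderive p v (fun q => eta q (Y q) : R)
    = eta p (nabla p v Y) + eta p v * g p (W p) (Y p).
Proof.
move=> sY; have -> : (fun q => eta q (Y q)) = (fun q => g q (Y q) (xi q)).
  by apply/funext => q; rewrite etaE.
rewrite (levi_civita_metric nabla_lc v sY (xi_smooth p)) F11_nabla_xi.
by rewrite -etaE linearZr_LR/= (g_sym _ (Y p)).
Qed.

Lemma eta_bracket p X Y : smooth_vf_at p X -> smooth_vf_at p Y ->
  eta p (bracket X Y p) = eta p (nabla p (X p) Y) - eta p (nabla p (Y p) X).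
Proof.
by move=> sX sY; rewrite -(levi_civita_torsion_free nabla_lc sX sY) linearB.
Qed.

(** Obtained by differentiating [F11_nabla_xi], which holds at every point. *)
Lemma F11_curvature_xi p X Y : smooth_vf_at p X -> smooth_vf_at p Y ->
  curvature nabla X Y xi p
    = eta p (Y p) *: nabla p (X p) W - eta p (X p) *: nabla p (Y p) W
      + (eta p (X p) * g p (W p) (Y p) - eta p (Y p) * g p (W p) (X p)) *: W p.
Proof.
move=> sX sY; rewrite /curvature.
have nE Z : (fun q => nabla q (Z q) xi) = (fun q => eta q (Z q) *: W q).
  by apply/funext => q; rewrite F11_nabla_xi.
have sE Z : smooth_vf_at p Z -> smooth_at p (fun q => eta q (Z q) : R).
  exact: (almost_contact_eta contact).
rewrite !nE F11_nabla_xi eta_bracket//.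
rewrite (connection_leibniz nabla_affine _ (sE _ sY) (W_smooth p)).
rewrite (connection_leibniz nabla_affine _ (sE _ sX) (W_smooth p)).
rewrite !tderive_eta//; apply/rowP => k; rewrite !mxE; ring.
Qed.

(** Near [p], [F11_nabla_phi] gives the derivative of [phi Z] along [Y], which
    is then differentiated along [X] by the Leibniz rule.  Pairing with a vector
    in the image of phi kills every multiple of xi. *)
Lemma F11_nabla_nabla_phi p X Y Z u :
  smooth_vf_at p X -> smooth_vf_at p Y -> smooth_vf_at p Z ->
  g p (nabla p (X p) (fun q => nabla q (Y q) (fun r => phi r (Z r)))) (phi p u)
    = g p (phi p (nabla p (X p) (fun q => nabla q (Y q) Z))) (phi p u)
      + (eta p (X p) * eta p (nabla p (Y p) Z)
         + (eta p (nabla p (X p) Y) + eta p (X p) * g p (W p) (Y p))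
           * eta p (Z p)
         + eta p (Y p)
           * (eta p (nabla p (X p) Z) + eta p (X p) * g p (W p) (Z p)))
        * g p (W p) u
      + eta p (Y p) * eta p (Z p) * g p (nabla p (X p) Omega) (phi p u)
      + eta p (Y p) * g p (Z p) (Omega p) * eta p (X p) * g p (W p) (phi p u).
Proof.
move=> sX sY sZ.
pose V q := nabla q (Y q) Z.
pose A q := eta q (Z q) *: Omega q + g q (Z q) (Omega q) *: xi q.
have sV : smooth_vf_at p V by exact: connection_smooth.
have seta T : smooth_vf_at p T -> smooth_at p (fun q => eta q (T q) : R).
  exact: (almost_contact_eta contact).
have sO : smooth_at p (fun q => g q (Z q) (Omega q) : R).
  exact: metric_smooth.
have sA1 := smooth_vf_scale (seta _ sZ) (Omega_smooth p).
have sA2 := smooth_vf_scale sO (xi_smooth p).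
have sA : smooth_vf_at p A by exact: smooth_vfD.
have sYA := smooth_vf_scale (seta _ sY) sA.
have sphiV : smooth_vf_at p (fun q => phi q (V q)).
  exact: (almost_contact_phi contact).
rewrite -(@nabla_eq _ _ _ _ nabla_affine _ _
  (fun q => phi q (V q) + eta q (Y q) *: A q)); first last.
- near=> q; rewrite F11_nabla_phi//; near: q; exact: smooth_vf_near.
- exact: smooth_vfD.
rewrite (connection_add nabla_affine _ sphiV sYA) F11_nabla_phi//.
rewrite (connection_leibniz nabla_affine _ (seta _ sY) sA).
rewrite (connection_add nabla_affine _ sA1 sA2).
rewrite (connection_leibniz nabla_affine _ (seta _ sZ) (Omega_smooth p)).
rewrite (connection_leibniz nabla_affine _ sO (xi_smooth p)).
rewrite !tderive_eta// F11_nabla_xi /A /V.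
have xi0 : g p (xi p) (phi p u) = 0 by rewrite gxi eta_phi.
have Ou : g p (Omega p) (phi p u) = g p (W p) u by rewrite phi_sym.
have gD x y : g p (x + y) (phi p u) = g p x (phi p u) + g p y (phi p u).
  exact: linearDl.
have gZ a x : g p (a *: x) (phi p u) = a * g p x (phi p u).
  exact: linearZl_LR.
rewrite !(gD, gZ) xi0 Ou; ring.
Unshelve. all: by end_near. Qed.

(** Antisymmetrizing [F11_nabla_nabla_phi] gives the commutator of the
    curvature operator with phi; the Norden identity replaces g(phi R, phi U)
    by - g(R, U) + eta(R) eta(U), and eta(R) is rewritten by skew-symmetry.  The
    derivative of Omega paired with phi U differs from that of [W] paired with
    U by a term in g(Omega, Omega), symmetric in [X] and [Y]. *)
Lemma F11_curvature_phi p X Y Z U :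
  smooth_vf_at p X -> smooth_vf_at p Y -> smooth_vf_at p Z ->
  smooth_vf_at p U ->
  curvature4 nabla g X Y (fun q => phi q (Z q)) (fun q => phi q (U q)) p
    + curvature4 nabla g X Y Z U p
    = - eta p (U p) * g p (curvature nabla X Y xi p) (Z p)
      + (eta p (X p) * g p (W p) (Y p) - eta p (Y p) * g p (W p) (X p))
        * eta p (Z p) * g p (W p) (U p)
      + eta p (Y p) * eta p (Z p) * g p (nabla p (X p) W) (U p)
      - eta p (X p) * eta p (Z p) * g p (nabla p (Y p) W) (U p).
Proof.
move=> sX sY sZ sU.
have sphiZ : smooth_vf_at p (fun q => phi q (Z q)).
  exact: (almost_contact_phi contact).
have RU : g p (curvature nabla X Y Z p) (xi p)
    = - g p (curvature nabla X Y xi p) (Z p).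
  by rewrite (curvature_skew g_metric nabla_lc sX sY sZ (xi_smooth p)) g_sym.
have RphiU : g p (phi p (curvature nabla X Y Z p)) (phi p (U p))
    = - g p (curvature nabla X Y Z p) (U p)
      - g p (curvature nabla X Y xi p) (Z p) * eta p (U p).
  by rewrite (acn_norden norden) etaE RU mulNr.
have nW v : g p (nabla p v W) (U p) = g p (nabla p v Omega) (phi p (U p))
    + eta p v * g p (Omega p) (Omega p) * eta p (U p).
  rewrite F11_nabla_phi; last exact: Omega_smooth.
  rewrite linearDl/= phi_sym; congr (_ + _).
  by rewrite linearZl_LR/= eta_Omega scale0r add0r linearZl_LR/= gxi mulrA.
have cE : curvature4 nabla g X Y (fun q => phi q (Z q)) (fun q => phi q (U q)) p
    = g p (phi p (curvature nabla X Y Z p)) (phi p (U p))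
      + (eta p (X p) * g p (W p) (Y p) - eta p (Y p) * g p (W p) (X p))
        * eta p (Z p) * g p (W p) (U p)
      + eta p (Y p) * eta p (Z p) * g p (nabla p (X p) Omega) (phi p (U p))
      - eta p (X p) * eta p (Z p) * g p (nabla p (Y p) Omega) (phi p (U p)).
  rewrite /curvature4 {1}/curvature 2!linearBl/= !F11_nabla_nabla_phi//.
  rewrite F11_nabla_phi// eta_bracket// /curvature.
  have xi0 : g p (xi p) (phi p (U p)) = 0 by rewrite gxi eta_phi.
  have Ou : g p (Omega p) (phi p (U p)) = g p (W p) (U p) by rewrite phi_sym.
  have gD x y : g p (x + y) (phi p (U p))
      = g p x (phi p (U p)) + g p y (phi p (U p)) by exact: linearDl.
  have gZ a x : g p (a *: x) (phi p (U p)) = a * g p x (phi p (U p)).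
    exact: linearZl_LR.
  have gN x : g p (- x) (phi p (U p)) = - g p x (phi p (U p)).
    exact: linearNl.
  rewrite !linearB/= !(gD, gN, gZ) xi0 Ou; ring.
rewrite cE RphiU !nW /curvature4; ring.
Qed.

(** The derivative along xi of the vanishing function eta(W). *)
Lemma F11_nabla_xi_W p : eta p (nabla p (xi p) W) = - g p (W p) (W p).
Proof.
have := tderive_eta (xi p) (W_smooth p).
have -> : (fun q => eta q (W q)) = (fun _ => 0 : R).
  by apply/funext => q; rewrite eta_W.
by rewrite tderive_cst eta_xi mul1r => /esym/eqP; rewrite addr_eq0 => /eqP.
Qed.

End F11.

(** * Metric traces *)

Section MetricTrace.
Variables (R : fieldType) (m : nat) (g : {biscalar 'rV[R]_m}).
Hypothesis g_sym : forall x y, g x y = g y x.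
Hypothesis g_nondeg : forall x, (forall y, g x y = 0) -> x = 0.
Variable b : 'I_m -> 'rV[R]_m.
Hypothesis b_basis : \matrix_i b i \in unitmx.

Let gram : 'M[R]_m := \matrix_(i, j) g (b i) (b j).

Definition metric_trace (f : 'rV[R]_m -> 'rV[R]_m -> R) : R :=
  \sum_i \sum_j invmx gram i j * f (b i) (b j).

Lemma metric_traceD f h :
  metric_trace (fun x y => f x y + h x y) = metric_trace f + metric_trace h.
Proof.
rewrite -big_split; apply: eq_bigr => i _; rewrite -big_split.
by apply: eq_bigr => j _; rewrite /= mulrDr.
Qed.

Lemma metric_traceZ k f :
  metric_trace (fun x y => k * f x y) = k * metric_trace f.
Proof.
rewrite mulr_sumr; apply: eq_bigr => i _; rewrite mulr_sumr.
by apply: eq_bigr => j _; rewrite mulrCA.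
Qed.

Lemma row_basis (c : 'rV[R]_m) : c *m (\matrix_i b i) = \sum_i c 0 i *: b i.
Proof. by rewrite mulmx_sum_row; apply: eq_bigr => i _; rewrite rowK. Qed.

Lemma basis_span x : exists c : 'I_m -> R, x = \sum_i c i *: b i.
Proof.
exists (fun i => (x *m invmx (\matrix_i b i)) 0 i).
by rewrite -row_basis mulmxKV.
Qed.

(** A vector in the kernel of the Gram matrix gives a combination of the basis
    that is orthogonal to every basis vector, hence zero. *)
Lemma gram_unit : gram \in unitmx.
Proof.
rewrite -row_free_unit; apply: inj_row_free => c cG.
suff c0 : c *m (\matrix_i b i) = 0 by rewrite -(mulmxK b_basis c) c0 mul0mx.
rewrite row_basis; apply: g_nondeg => y; have [d ->] := basis_span y.
rewrite linear_sumr big1// => j _; rewrite linearZr_LR/= linear_sumlz.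
have -> : \sum_i g (c 0 i *: b i) (b j) = (c *m gram) 0 j.
  by rewrite mxE; apply: eq_bigr => i _; rewrite !mxE linearZl_LR.
by rewrite cG mxE mulr0.
Qed.

Lemma invmx_gram i k :
  \sum_j invmx gram i j * g (b k) (b j) = (i == k)%:R.
Proof.
have := mulVmx gram_unit => /matrixP/(_ i k); rewrite !mxE => <-.
by apply: eq_bigr => j _; rewrite mxE g_sym.
Qed.

(** The covector g(v, -) has the coordinates of [v] multiplied by the Gram
    matrix as its components, so the inverse matrix recovers them. *)
Lemma gram_coord (c : 'I_m -> R) i :
  \sum_j invmx gram i j * g (\sum_k c k *: b k) (b j) = c i.
Proof.
under eq_bigr do rewrite linear_sumlz mulr_sumr.
rewrite exchange_big (bigD1 i)//= [X in _ + X]big1 => [|k ki].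
  under eq_bigr do rewrite linearZl_LR mulrCA.
  by rewrite -mulr_sumr invmx_gram eqxx mulr1 addr0.
under eq_bigr do rewrite linearZl_LR mulrCA.
by rewrite -mulr_sumr invmx_gram eq_sym (negPf ki) mulr0.
Qed.

Lemma metric_trace_dual (f : {scalar 'rV[R]_m}) v :
  metric_trace (fun x y => f x * g v y) = f v.
Proof.
have [c ->] := basis_span v; rewrite linear_sum; apply: eq_bigr => i _.
under eq_bigr do rewrite mulrCA.
by rewrite -mulr_sumr gram_coord linearZ mulrC.
Qed.

(** In the basis [b] the endomorphism has a matrix conjugate to [lin1_mx f],
    whose diagonal coefficients are given by [gram_coord]. *)
Lemma metric_trace_endo (f : {linear 'rV[R]_m -> 'rV[R]_m}) :
  metric_trace (fun x y => g (f x) y) = \tr (lin1_mx f).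
Proof.
pose B : 'M[R]_m := \matrix_i b i; pose C := B *m lin1_mx f *m invmx B.
have fb i : f (b i) = \sum_k C i k *: b k.
  have -> : \sum_k C i k *: b k = row i (C *m B).
    by rewrite row_mul row_basis; apply: eq_bigr => k _; rewrite [in RHS]mxE.
  by rewrite mulmxKV// row_mul rowK mul_rV_lin1.
have -> : \tr (lin1_mx f) = \tr C.
  by rewrite mxtrace_mulC mulmxA mulVmx// mul1mx.
by apply: eq_bigr => i _; rewrite fb gram_coord.
Qed.

End MetricTrace.

Section Traces.
Variables (R : realType) (m : nat) (M : smooth_manifold R m).
Variables (phi : M -> {linear 'rV[R]_m -> 'rV[R]_m}).
Variables (g : M -> {biscalar 'rV[R]_m}).
Variable nabla : M -> 'rV[R]_m -> vfield M -> 'rV[R]_m.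
Hypothesis g_metric : pseudo_riemannian g.
Hypothesis nabla_lc : levi_civita nabla g.
Variables (p : M) (e : 'I_m -> vfield M).
Hypothesis e_frame : frame_at p e.

Local Notation tr := (metric_trace (g p) (fun i => e i p)).

Lemma frame_trace_dual (f : 'rV[R]_m -> R) v : scalar f ->
  tr (fun x y => f x * g p v y) = f v.
Proof.
move=> lin; have [_ eb] := e_frame.
pose linM := GRing.isLinear.Build _ _ _ _ _ lin.
pose F : {scalar _} := HB.pack f linM.
apply: (metric_trace_dual _ _ eb F).
  exact: Defs.metric_sym g_metric p.
exact: metric_nondegenerate g_metric p.
Qed.

Lemma frame_divergence (X : vfield M) : smooth_vf_at p X ->
  tr (fun x y => g p (nabla p x X) y) = divergence nabla X p.
Proof.
move=> sX; have [_ eb] := e_frame.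
have lin : linear (fun v => nabla p v X).
  move=> a u v.
  by rewrite (connection_linear (levi_civita_connection nabla_lc)).
pose linM := GRing.isLinear.Build _ _ _ _ _ lin.
pose L : {linear _ -> _} := HB.pack (fun v => nabla p v X) linM.
apply: (metric_trace_endo _ _ eb L).
  exact: Defs.metric_sym g_metric p.
exact: metric_nondegenerate g_metric p.
Qed.

(** Reordering the sums pairs the index of the first argument of the curvature
    with that of the fourth, and the second with the third, in both
    invariants. *)
Lemma scalar_curvature_sum :
  scalar_curvature nabla g e p + scalar_curvature_star2 nabla g phi e p
  = \sum_i \sum_s inv_gram g e p i s * \sum_j \sum_k inv_gram g e p j k *
     (curvature4 nabla g (e i) (e j) (fun q => phi q (e k q))
        (fun q => phi q (e s q)) p
      + curvature4 nabla g (e i) (e j) (e k) (e s) p).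
Proof.
set H := inv_gram g e p.
have -> : scalar_curvature nabla g e p = \sum_i \sum_s H i s *
    \sum_j \sum_k H j k * curvature4 nabla g (e i) (e j) (e k) (e s) p.
  rewrite /scalar_curvature /ricci -/H !pair_bigA/=.
  under eq_bigr do rewrite pair_bigA mulr_sumr/=.
  under [RHS]eq_bigr do rewrite pair_bigA mulr_sumr/=.
  rewrite exchange_big/=; apply: eq_bigr => a _; apply: eq_bigr => c _.
  exact: mulrCA.
have -> : scalar_curvature_star2 nabla g phi e p = \sum_i \sum_s H i s *
    \sum_j \sum_k H j k * curvature4 nabla g (e i) (e j)
      (fun q => phi q (e k q)) (fun q => phi q (e s q)) p.
  apply: eq_bigr => i _; under eq_bigr do rewrite exchange_big/=.
  rewrite exchange_big/=; apply: eq_bigr => s _; rewrite mulr_sumr.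
  apply: eq_bigr => j _; rewrite mulr_sumr; apply: eq_bigr => k _.
  by rewrite -mulrA.
rewrite addrC -big_split; apply: eq_bigr => i _; rewrite -big_split.
apply: eq_bigr => s _; rewrite /= -mulrDr; congr (_ * _).
rewrite -big_split; apply: eq_bigr => j _; rewrite -big_split.
by apply: eq_bigr => k _; rewrite /= -mulrDr.
Qed.

End Traces.

(** * The scalar curvature identities *)

Theorem proposition2p2 (R : realType) (n : nat)
  (M : smooth_manifold R n.*2.+1)
  (phi : M -> {linear 'rV[R]_n.*2.+1 -> 'rV[R]_n.*2.+1})
  (xi : vfield M)
  (eta : M -> {scalar 'rV[R]_n.*2.+1})
  (g : M -> {biscalar 'rV[R]_n.*2.+1})
  (nabla : M -> 'rV[R]_n.*2.+1 -> vfield M -> 'rV[R]_n.*2.+1)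
  (Omega : vfield M)
  (hM : almost_contact_norden phi xi eta g)
  (hnabla : levi_civita nabla g)
  (hOmega : smooth_vf Omega)
  (hOmegaE : forall p (X : vfield M), smooth_vf_at p X ->
     omega nabla g phi xi X p = g p (X p) (Omega p))
  (hF11 : class_F11 nabla g phi xi eta) :
  forall (p : M) (e : 'I_(n.*2.+1) -> vfield M), frame_at p e ->
    scalar_curvature nabla g e p + scalar_curvature_star2 nabla g phi e p
      = 2 * divergence nabla (fun q => phi q (Omega q)) p /\
    2 * divergence nabla (fun q => phi q (Omega q)) p
      = 2 * ricci nabla g e xi xi p.
Proof.
move=> p e ep; have [se _] := ep.
have contact := acn_almost_contact hM; have gm := acn_metric hM.
have sxi := almost_contact_xi contact.
pose W : vfield M := fun q => phi q (Omega q).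
have sW : smooth_vf_at p W by exact: (almost_contact_phi contact).
rewrite -/W.
pose D x := nabla p x W; pose d := divergence nabla W p.
pose w x := g p (W p) x.
have gsym := Defs.metric_sym gm p.
have gxi x : g p (xi p) x = eta p x by rewrite gsym (norden_eta hM).
have eta_xi : eta p (xi p) = 1 := almost_contact_dual contact p.
have eta_W : eta p (W p) = 0 := norden_eta_phi hM p (Omega p).
have w_xi : w (xi p) = 0 by rewrite /w gsym gxi.
have eta_D : eta p (D (xi p)) = - w (W p).
  exact: (F11_nabla_xi_W hM hnabla hOmega hOmegaE hF11).
have dualE := frame_trace_dual gm ep.
have divE := frame_divergence gm hnabla ep sW.
have D_lin := connection_linear (levi_civita_connection hnabla) _ _ _ sW.
have eta_lin : scalar (eta p) by move=> a x y; rewrite linearP.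
have w_lin : scalar w by move=> a x y; rewrite /w linearPr.
have etaD_lin : scalar (fun x => eta p (D x)).
  by move=> a x y; rewrite /D D_lin linearP.
have gD_lin u : scalar (fun x => g p (D x) u).
  by move=> a x y; rewrite /D D_lin linearPl.
have g_combination a x b y c z u : g p (a *: x - b *: y + c *: z) u
    = a * g p x u - b * g p y u + c * g p z u.
  by rewrite linearDl linearBl/= !linearZl_LR.
pose tr := metric_trace (g p) (fun i => e i p).
have ricE : ricci nabla g e xi xi p = d.
  pose r x y := g p (D x) y + (- 1) * (eta p x * g p (D (xi p)) y)
    + (- 1) * (w x * g p (W p) y).
  have -> : ricci nabla g e xi xi p = tr r.
    apply: eq_bigr => i _; apply: eq_bigr => j _; congr (_ * _).
    rewrite /curvature4.
    rewrite (F11_curvature_xi hM hnabla hOmega hOmegaE hF11 (se i) (sxi p)).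
    by rewrite g_combination eta_xi -/(w (xi p)) w_xi /r /w /D; ring.
  rewrite /r /tr !metric_traceD !metric_traceZ divE !dualE// eta_D -/d; ring.
split; last by rewrite ricE.
rewrite scalar_curvature_sum.
(* The curvature sum is written with the terms [f y * g v z] and [g (D y) z]
   that the trace rules evaluate; [T'] is its trace in [y] and [z], written in
   the same way. *)
pose T x y z u :=
    (- eta p u) * (eta p y * g p (D x) z)
  + (eta p u * eta p x) * g p (D y) z
  + (- (eta p u * eta p x)) * (w y * g p (W p) z)
  + (eta p u * w x) * (eta p y * g p (W p) z)
  + (eta p x * w u) * (w y * g p (xi p) z)
  + (- (w x * w u)) * (eta p y * g p (xi p) z)
  + g p (D x) u * (eta p y * g p (xi p) z)
  + (- eta p x) * (g p (D y) u * g p (xi p) z).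
pose T' x u :=
    (- 1) * (eta p (D x) * g p (xi p) u)
  + (d - w (W p)) * (eta p x * g p (xi p) u)
  + (- 1) * (w x * g p (W p) u)
  + g p (D x) u
  + (- 1) * (eta p x * g p (D (xi p)) u).
have innerE x u : tr (fun y z => T x y z u) = T' x u.
  rewrite /T /tr !metric_traceD !metric_traceZ divE !dualE//.
  rewrite /T' eta_W eta_xi w_xi !gxi -/d -/(w u); ring.
transitivity (tr T').
  apply: eq_bigr => i _; apply: eq_bigr => s _; congr (_ * _).
  rewrite -innerE; apply: eq_bigr => j _; apply: eq_bigr => k _; congr (_ * _).
  rewrite (F11_curvature_phi hM hnabla hOmega hOmegaE hF11
    (se i) (se j) (se k) (se s)).
  rewrite (F11_curvature_xi hM hnabla hOmega hOmegaE hF11 (se i) (se j)).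
  rewrite g_combination /T !gxi /w /D; ring.
rewrite /T' /tr !metric_traceD !metric_traceZ divE !dualE//.
rewrite eta_D eta_xi -/d; ring.
Qed.
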